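(* Let $\phi=\frac{1+\sqrt5}{2}$. Define the vector field $\mathfrak{V}=(\mathfrak{V}_x,\mathfrak{V}_y,\mathfrak{V}_z)$ on $\mathbb{R}^3$ by $\mathfrak{V}_y(x,y,z)=\mathfrak{V}_x(y,z,x)$, $\mathfrak{V}_z(x,y,z)=\mathfrak{V}_x(z,x,y)$, where $$\begin{aligned} \mathfrak{V}_x(x,y,z)={}&2x\sin\tfrac{x}{2}\sin\tfrac{\phi y}{2}\sin\tfrac{z}{2\phi}-2\phi x\sin\tfrac{x}{2\phi}\sin\tfrac{y}{2}\sin\tfrac{\phi z}{2}+2\phi^{-1}x\sin\tfrac{\phi x}{2}\sin\tfrac{y}{2\phi}\sin\tfrac{z}{2}\\ &+y\sin z+2y\cos\tfrac{x}{2}\cos\tfrac{\phi y}{2}\sin\tfrac{z}{2\phi}-2y\cos\tfrac{x}{2\phi}\cos\tfrac{y}{2}\sin\tfrac{\phi z}{2}\\ &+z\sin y-2z\cos\tfrac{x}{2}\sin\tfrac{\phi y}{2}\cos\tfrac{z}{2\phi}+2z\cos\tfrac{\phi x}{2}\sin\tfrac{y}{2\phi}\cos\tfrac{z}{2}, \end{aligned}$$ and the vector field $\mathfrak{W}=(\mathfrak{W}_x,\mathfrak{W}_y,\mathfrak{W}_z)$ by $\mathfrak{W}_y(x,y,z)=\mathfrak{W}_x(y,z,x)$, $\mathfrak{W}_z(x,y,z)=\mathfrak{W}_x(z,x,y)$, where $$\begin{aligned} \mathfrak{W}_x(x,y,z)={}&x\cos y-x\cos z\\ &-\sqrt5\,x\cos\tfrac{x}{2}\cos\tfrac{\phi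 y}{2}\cos\tfrac{z}{2\phi}+\phi x\cos\tfrac{x}{2\phi}\cos\tfrac{y}{2}\cos\tfrac{\phi z}{2}+\phi^{-1}x\cos\tfrac{\phi x}{2}\cos\tfrac{y}{2\phi}\cos\tfrac{z}{2}\\ &-\phi^{-2}y\sin\tfrac{x}{2}\sin\tfrac{\phi y}{2}\cos\tfrac{z}{2\phi}-\phi^{2}y\sin\tfrac{x}{2\phi}\sin\tfrac{y}{2}\cos\tfrac{\phi z}{2}+\sqrt5\,y\sin\tfrac{\phi x}{2}\sin\tfrac{y}{2\phi}\cos\tfrac{z}{2}\\ &-\phi^{2}z\sin\tfrac{x}{2}\cos\tfrac{\phi y}{2}\sin\tfrac{z}{2\phi}-\phi^{-2}z\sin\tfrac{\phi x}{2}\cos\tfrac{y}{2\phi}\sin\tfrac{z}{2}+\sqrt5\,z\sin\tfrac{x}{2\phi}\cos\tfrac{y}{2}\sin\tfrac{\phi z}{2}. \end{aligned}$$ Then: 1) The vector field $\mathfrak{I}=(\mathfrak{I}_x,\mathfrak{I}_y,\mathfrak{I}_z)=\mathfrak{V}+\mathfrak{W}$ has icosahedral symmetry: as a map $\mathbb{R}^3\to\mathbb{R}^3$ it satisfies $\zeta^{-1}\circ\mathfrak{I}\circ\zeta=\mathfrak{I}$ for every $\zeta\in\mathbb{I}$. Moreover, $\mathfrak{W}$ has the full icosahedral symmetry, i.e. $\zeta^{-1}\circ\mathfrak{W}\circ\zeta=\mathfrak{W}$ for every $\zeta\in\mathbb{I}\times\{I,-I\}$. 2) The Taylor series of $\mathfrak{V}$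 at the origin contains only terms of even compound degree, that of $\mathfrak{W}$ contains only terms of odd compound degree, $\nabla\times\mathfrak{V}=\mathfrak{W}$ and $\nabla\times\mathfrak{W}=\mathfrak{V}$; thus $\nabla\times\mathfrak{I}=\mathfrak{I}$. 3) The Taylor series of $\mathfrak{V}$ at the origin starts with the degree $6$ vector field $\frac{\mathbf{M}}{768}$, where $\mathbf{M}=(\varpi,\varrho,\sigma)$ is given by $$\begin{aligned} \varpi&=(5-\sqrt5)yz^5+(5+\sqrt5)y^5z-20y^3z^3+(10+10\sqrt5)x^2yz^3+(10-10\sqrt5)x^2y^3z-10x^4yz,\\ \varrho&=(5-\sqrt5)zx^5+(5+\sqrt5)z^5x-20z^3x^3+(10+10\sqrt5)y^2zx^3+(10-10\sqrt5)y^2z^3x-10y^4zx,\\ \sigma&=(5-\sqrt5)xy^5+(5+\sqrt5)x^5y-20x^3y^3+(10+10\sqrt5)z^2xy^3+(10-10\sqrt5)z^2x^3y-10z^4xy; \end{aligned}$$ the Taylor series of $\mathfrak{W}$ at the origin starts with the degree $5$ vector field $\frac{\mathbf{N}}{768}$, where $\mathbf{N}=(\lambda,\xi,\chi)$, $\xi(x,y,z)=\lambda(y,z,x)$, $\chi(x,y,z)=\lambda(z,x,y)$, and $$\lambda=(35-5\sqrt5)xy^4-(35+5\sqrt5)xz^4+60\sqrt5\,xy^2z^2-(70+10\sqrt5)x^3y^2+(70-10\sqrt5)x^3z^2+2\sqrt5\,x^5.$$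
   Context: The icosahedral group $\mathbb{I}\subset SO(3)$ is the group of order $60$ generated by the matrices $$\alpha=\begin{pmatrix}-1&0&0\\0&-1&0\\0&0&1\end{pmatrix},\quad \beta=\begin{pmatrix}0&0&1\\1&0&0\\0&1&0\end{pmatrix},\quad \gamma=\begin{pmatrix}\frac12&-\frac{\phi}{2}&\frac{1}{2\phi}\\ \frac{\phi}{2}&\frac{1}{2\phi}&-\frac12\\ \frac{1}{2\phi}&\frac12&\frac{\phi}{2}\end{pmatrix},\qquad \phi=\frac{1+\sqrt5}{2},$$ acting on column vectors of $\mathbb{R}^3$; $I$ is the identity matrix, and $\mathbb{I}\times\{I,-I\}=\{\pm\zeta:\zeta\in\mathbb{I}\}$. A vector field is regarded as a map $\mathbb{R}^3\to\mathbb{R}^3$, so $(\zeta^{-1}\circ\mathbf{B}\circ\zeta)(\mathbf{x})=\zeta^{-1}\mathbf{B}(\zeta\mathbf{x})$. For $\mathbf{B}=(u,v,w)$, $\nabla\times\mathbf{B}=\left(\frac{\partial w}{\partial y}-\frac{\partial v}{\partial z},\frac{\partial u}{\partial z}-\frac{\partial w}{\partial x},\frac{\partial v}{\partial x}-\frac{\partial u}{\partial y}\right)$. Compound degree means total degree in $x,y,z$. ''The Taylor series starts with a degree $d$ vector field'' means that this field is the lowest-degree nonzero homogeneous component of the Taylor series at the origin. *)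

(* Defs.v *)
From HB Require Import structures.
From mathcomp Require Import all_boot all_order all_algebra.
From mathcomp Require Import all_classical all_reals all_analysis.

Set Implicit Arguments.
Unset Strict Implicit.
Unset Printing Implicit Defensive.

Import Order.TTheory GRing.Theory Num.Theory.
Import numFieldNormedType.Exports.

Local Open Scope classical_set_scope.
Local Open Scope ring_scope.

Definition vec3 (R : realType) (a b c : R) : 'cV[R]_3 :=
  \col_(i < 3) nth 0 [:: a; b; c] i.

Definition mx3 (R : realType) (a b c d e f g h k : R) : 'M[R]_3 :=
  \matrix_(i < 3, j < 3)
    nth 0 (nth [::] [:: [:: a; b; c]; [:: d; e; f]; [:: g; h; k]] i) j.

Definition phi (R : realType) : R := (1 + Num.sqrt 5) / 2.

Inductive generated_group (R : realType) (n : nat) (S : set 'M[R]_n) :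
    set 'M[R]_n :=
| gen_in A : S A -> generated_group S A
| gen_one : generated_group S 1%:M
| gen_mul A B : generated_group S A -> generated_group S B ->
    generated_group S (A *m B)
| gen_inv A : generated_group S A -> generated_group S (invmx A).

Definition ico_alpha (R : realType) : 'M[R]_3 :=
  mx3 (-1)  0   0
       0  (-1)  0
       0    0   1.

Definition ico_beta (R : realType) : 'M[R]_3 :=
  mx3 0 0 1
      1 0 0
      0 1 0.

Definition ico_gamma (R : realType) : 'M[R]_3 :=
  let phi := phi R in
  mx3 (1 / 2)          (- (phi / 2))   (1 / (2 * phi))
      (phi / 2)        (1 / (2 * phi)) (- (1 / 2))
      (1 / (2 * phi))  (1 / 2)         (phi / 2).

Definition icosahedral (R : realType) : set 'M[R]_3 :=
  generated_group [set ico_alpha R; ico_beta R; ico_gamma R].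

Definition full_icosahedral (R : realType) : set 'M[R]_3 :=
  [set A | exists2 zeta, icosahedral zeta & A = zeta \/ A = - zeta].

Definition symmetric_under (R : realType) (zeta : 'M[R]_3)
    (B : 'cV[R]_3 -> 'cV[R]_3) : Prop :=
  mulmx (invmx zeta) \o B \o mulmx zeta = B.

Definition partial (R : realType) (W : normedModType R) (i : 'I_3)
    (f : 'cV[R]_3 -> W) : 'cV[R]_3 -> W :=
  fun p => 'D_(delta_mx i 0) f p.

(* Derivatives are total (with a junk value where the limit does not exist), so
   [smooth] is required explicitly wherever a Taylor series is mentioned. *)
Definition smooth (R : realType) (F : 'cV[R]_3 -> 'cV[R]_3) : Prop :=
  forall (s : seq 'I_3) (p : 'cV[R]_3), differentiable (foldr (@partial R _) F s) p.

Definition curl (R : realType) (B : 'cV[R]_3 -> 'cV[R]_3) :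
    'cV[R]_3 -> 'cV[R]_3 := fun p =>
  let u q := B q 0 0 in let v q := B q 1 0 in let w q := B q 2 0 in
  vec3 (partial 1 w p - partial 2 v p)
       (partial 2 u p - partial 0 w p)
       (partial 0 v p - partial 1 u p).

(* The vector coefficient of x^(a 0) y^(a 1) z^(a 2) in the Taylor series at 0. *)
Definition taylor_coef (R : realType) (F : 'cV[R]_3 -> 'cV[R]_3)
    (a : 'I_3 -> nat) : 'cV[R]_3 :=
  (\prod_(i < 3) (a i)`!%:R)^-1 *:
    iter (a 0) (partial 0) (iter (a 1) (partial 1) (iter (a 2) (partial 2) F)) 0.

(* Exponents of a monomial of degree d are at most d, so the sum ranges over all
   multi-indices of length d. *)
Definition taylor_component (R : realType) (F : 'cV[R]_3 -> 'cV[R]_3) (d : nat) :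
    'cV[R]_3 -> 'cV[R]_3 := fun p =>
  \sum_(a : {ffun 'I_3 -> 'I_d.+1} | (\sum_(i < 3) a i)%N == d)
    (\prod_(i < 3) p i 0 ^+ a i) *: taylor_coef F (fun i => a i).

Definition taylor_only_even (R : realType) (F : 'cV[R]_3 -> 'cV[R]_3) : Prop :=
  smooth F /\
  forall a : 'I_3 -> nat, taylor_coef F a != 0 -> ~~ odd (\sum_(i < 3) a i)%N.

Definition taylor_only_odd (R : realType) (F : 'cV[R]_3 -> 'cV[R]_3) : Prop :=
  smooth F /\
  forall a : 'I_3 -> nat, taylor_coef F a != 0 -> odd (\sum_(i < 3) a i)%N.

Definition taylor_starts_with (R : realType) (F : 'cV[R]_3 -> 'cV[R]_3)
    (d : nat) (P : 'cV[R]_3 -> 'cV[R]_3) : Prop :=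
  [/\ smooth F,
      forall e : nat, (e < d)%N -> taylor_component F e = cst 0,
      taylor_component F d = P
    & P <> cst 0].

Definition cyclic_field (R : realType) (f : R -> R -> R -> R) :
    'cV[R]_3 -> 'cV[R]_3 := fun p =>
  let x := p 0 0 in let y := p 1 0 in let z := p 2 0 in
  vec3 (f x y z) (f y z x) (f z x y).

Definition V_x (R : realType) (x y z : R) : R :=
  let phi := phi R in
    2 * x * sin (x / 2) * sin (phi * y / 2) * sin (z / (2 * phi))
  - 2 * phi * x * sin (x / (2 * phi)) * sin (y / 2) * sin (phi * z / 2)
  + 2 * phi^-1 * x * sin (phi * x / 2) * sin (y / (2 * phi)) * sin (z / 2)
  + y * sin z
  + 2 * y * cos (x / 2) * cos (phi * y / 2) * sin (z / (2 * phi))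
  - 2 * y * cos (x / (2 * phi)) * cos (y / 2) * sin (phi * z / 2)
  + z * sin y
  - 2 * z * cos (x / 2) * sin (phi * y / 2) * cos (z / (2 * phi))
  + 2 * z * cos (phi * x / 2) * sin (y / (2 * phi)) * cos (z / 2).

Definition W_x (R : realType) (x y z : R) : R :=
  let phi := phi R in
  let sqrt5 := Num.sqrt 5 in
    x * cos y - x * cos z
  - sqrt5 * x * cos (x / 2) * cos (phi * y / 2) * cos (z / (2 * phi))
  + phi * x * cos (x / (2 * phi)) * cos (y / 2) * cos (phi * z / 2)
  + phi^-1 * x * cos (phi * x / 2) * cos (y / (2 * phi)) * cos (z / 2)
  - phi ^- 2 * y * sin (x / 2) * sin (phi * y / 2) * cos (z / (2 * phi))
  - phi ^+ 2 * y * sin (x / (2 * phi)) * sin (y / 2) * cos (phi * z / 2)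
  + sqrt5 * y * sin (phi * x / 2) * sin (y / (2 * phi)) * cos (z / 2)
  - phi ^+ 2 * z * sin (x / 2) * cos (phi * y / 2) * sin (z / (2 * phi))
  - phi ^- 2 * z * sin (phi * x / 2) * cos (y / (2 * phi)) * sin (z / 2)
  + sqrt5 * z * sin (x / (2 * phi)) * cos (y / 2) * sin (phi * z / 2).

Definition V_field (R : realType) : 'cV[R]_3 -> 'cV[R]_3 := cyclic_field (@V_x R).

Definition W_field (R : realType) : 'cV[R]_3 -> 'cV[R]_3 := cyclic_field (@W_x R).

Definition I_field (R : realType) : 'cV[R]_3 -> 'cV[R]_3 :=
  V_field (R := R) \+ W_field (R := R).

Definition M_field (R : realType) : 'cV[R]_3 -> 'cV[R]_3 := fun p =>
  let sqrt5 := Num.sqrt 5 in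
  let x := p 0 0 in let y := p 1 0 in let z := p 2 0 in
  vec3
    ((5 - sqrt5) * y * z ^+ 5 + (5 + sqrt5) * y ^+ 5 * z
     - 20 * y ^+ 3 * z ^+ 3 + (10 + 10 * sqrt5) * x ^+ 2 * y * z ^+ 3
     + (10 - 10 * sqrt5) * x ^+ 2 * y ^+ 3 * z - 10 * x ^+ 4 * y * z)
    ((5 - sqrt5) * z * x ^+ 5 + (5 + sqrt5) * z ^+ 5 * x
     - 20 * z ^+ 3 * x ^+ 3 + (10 + 10 * sqrt5) * y ^+ 2 * z * x ^+ 3
     + (10 - 10 * sqrt5) * y ^+ 2 * z ^+ 3 * x - 10 * y ^+ 4 * z * x)
    ((5 - sqrt5) * x * y ^+ 5 + (5 + sqrt5) * x ^+ 5 * y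
     - 20 * x ^+ 3 * y ^+ 3 + (10 + 10 * sqrt5) * z ^+ 2 * x * y ^+ 3
     + (10 - 10 * sqrt5) * z ^+ 2 * x ^+ 3 * y - 10 * z ^+ 4 * x * y).

Definition N_x (R : realType) (x y z : R) : R :=
  let sqrt5 := Num.sqrt 5 in
    (35 - 5 * sqrt5) * x * y ^+ 4 - (35 + 5 * sqrt5) * x * z ^+ 4
  + 60 * sqrt5 * x * y ^+ 2 * z ^+ 2 - (70 + 10 * sqrt5) * x ^+ 3 * y ^+ 2
  + (70 - 10 * sqrt5) * x ^+ 3 * z ^+ 2 + 2 * sqrt5 * x ^+ 5.

Definition N_field (R : realType) : 'cV[R]_3 -> 'cV[R]_3 := cyclic_field (@N_x R).

(* Main.v *)
Require Import Defs.
From HB Require Import structures.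
From mathcomp Require Import all_boot all_order all_algebra.
From mathcomp Require Import all_classical all_reals all_analysis.
From mathcomp Require Import ring.
Set Implicit Arguments.
Unset Strict Implicit.
Unset Printing Implicit Defensive.
Import Order.TTheory GRing.Theory Num.Theory.
Import numFieldNormedType.Exports.
Local Open Scope classical_set_scope.
Local Open Scope ring_scope.

(** Expanding the products of sines and cosines into sums turns both fields into
    superpositions of fifteen plane waves whose wave vectors are, up to sign,
    the thirty unit vectors to the vertices of an icosidodecahedron.  These
    fifteen vectors form five orthonormal frames (the axes of the five cubes
    inscribed in a dodecahedron), namely the columns of the powers of gamma.
    If [(a, b, n)] is a right-handed orthonormal triad, where [n] runs through
    the fifteen vectors and [a], [b] are the other two vectors of its frame,
    then
      V = sum of sin(n.p) ((b.p) a + (a.p) b),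
      W = sum of cos(n.p) ((b.p) b - (a.p) a)
    ([V_field_beams], [W_field_beams]).  In this form every claim is visible.

    Curl.  The curl of a wave [(c.p) g(n.p) u] is
    [g(n.p) c x u + (c.p) g'(n.p) n x u].  In both sums the first terms cancel
    within a triad, and [n x a = b], [n x b = - a] exchange the two sums
    ([curl_V_beams], [curl_W_beams]).

    Symmetry.  As gamma has order five, it permutes the five frames and hence
    the triads, so both fields commute with it ([V_gamma], [W_gamma]).  The
    generator beta is the cyclic shift of the coordinates, and alpha only uses
    the parity of sine and cosine.  Equivariance passes from the generators to
    the group, and W is odd.

    Taylor series.  The directional derivatives of a wave
    [(c.p) g(n.p) u] are combinations of waves of the same kind with [g]
    replaced by its derivatives, and the derivation along a basis vector acts
    on the coefficients as multiplication by a linear polynomial.  Together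
    with the multinomial theorem this gives the homogeneous component of degree
    [d + 1] as [g^(d)(0) (c.p) (n.p)^d / d! u], as one expects from the series
    of [g] ([taylor_component_beamsS]).  Parity follows from the values of the
    derivatives of sine at 0, and the vanishing of the low components and the
    values of the first nonzero ones are polynomial identities modulo
    phi^2 = phi + 1. *)

(** * The multinomial theorem *)

Section Multinomial.
Variables (F : numFieldType) (A : comAlgType F).

Let divpow (j : nat) (x : A) : A := j`!%:R^-1 *: x ^+ j.

Lemma divpowD j x y :
  divpow j (x + y) = \sum_(i < j.+1) divpow i x * divpow (j - i) y.
Proof.
rewrite /divpow addrC exprDn scaler_sumr; apply: eq_bigr => i _.
rewrite -scalerAl -scalerAr scalerA [y ^+ _ * _]mulrC.
rewrite -[_ *+ 'C(_, _)]scaler_nat scalerA; congr (_ *: _).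
have ij : (i <= j)%N by rewrite -ltnS.
have nz k : k`!%:R != 0 :> F by rewrite pnatr_eq0 -lt0n fact_gt0.
rewrite -(bin_fact ij) !natrM; field; rewrite !nz /=.
by rewrite pnatr_eq0 -lt0n bin_gt0.
Qed.

(** Both sides are the coefficient of degree [d] of the product of the
    exponential series of the [x i], truncated beyond degree [d] so that the
    product can be distributed over finitely many exponents. *)
Lemma multinomial n d (x : 'I_n -> A) :
  \sum_(a : {ffun 'I_n -> 'I_d.+1} | (\sum_i a i)%N == d)
     \prod_i ((a i)`!%:R^-1 *: x i ^+ a i) =
  d`!%:R^-1 *: (\sum_i x i) ^+ d.
Proof.
pose e y : {poly A} := \poly_(j < d.+1) divpow j y.
transitivity ((\prod_i e (x i))`_d); last first.
  suff H j : (j <= d)%N -> (\prod_i e (x i))`_j = divpow j (\sum_i x i).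
    exact: H.
  elim/big_rec2: _ j => [|i S P _ IH] j jd.
    rewrite coef1 /divpow; case: j jd => [|j] _; first by rewrite invr1 scale1r.
    by rewrite expr0n scaler0.
  rewrite coefM divpowD; apply: eq_bigr => k _.
  rewrite IH ?(leq_trans (leq_subr _ _)) // coef_poly ifT // ltnS.
  by apply: leq_trans jd; rewrite -ltnS.
under [in RHS]eq_bigr => i _ do rewrite /e poly_def.
rewrite bigA_distr_bigA coef_sum [LHS]big_mkcond; apply: eq_bigr => a _.
have -> : \prod_i (divpow (a i) (x i) *: 'X^(a i)) =
    (\prod_i divpow (a i) (x i)) *: 'X^(\sum_i a i) :> {poly A}.
  by rewrite scaler_prod expr_sum.
rewrite coefZ coefXn eq_sym.
by case: eqP => _; rewrite ?mulr1 ?mulr0.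
Qed.

End Multinomial.

(** * Linear forms and the successive derivatives of sine *)

Section Phase.
Variable R : realType.
Implicit Types c n p v : 'cV[R]_3.

Definition dot c p : R := \sum_i c i 0 * p i 0.

Lemma dot_is_linear c : linear (dot c).
Proof.
move=> k p v; rewrite /dot scaler_sumr -big_split; apply: eq_bigr => i _ /=.
by rewrite !mxE /GRing.scale /=; ring.
Qed.

HB.instance Definition _ c :=
  GRing.isLinear.Build R 'cV[R]_3 R _ (dot c) (dot_is_linear c).

Lemma dotE c p : dot c p = (c^T *m p) 0 0.
Proof. by rewrite mxE; apply: eq_bigr => i _; rewrite mxE. Qed.

Lemma dotM (g : 'M[R]_3) c p :
  g^T *m g = 1 -> dot (g *m c) (g *m p) = dot c p.
Proof.
by move=> gg; rewrite !dotE trmx_mul mulmxA -(mulmxA _ _ g) gg mulmx1.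
Qed.

Lemma dot_delta c i : dot c (delta_mx i 0) = c i 0.
Proof.
rewrite /dot (bigD1 i) //= mxE !eqxx mulr1 big1 ?addr0 // => j ji.
by rewrite mxE (negbTE ji) mulr0.
Qed.

Lemma differentiable_dot c p : differentiable (dot c) p.
Proof.
have -> : dot c = \sum_(i < 3) c i 0 *: (fun q : 'cV[R]_3 => q i 0).
  by apply/funext=> q; rewrite fct_sumE.
apply: differentiable_sum => i.
by apply: differentiableZ; exact: differentiable_coord.
Qed.

Lemma diff_dot c p : 'd (dot c) p = dot c :> ('cV[R]_3 -> R).
Proof.
by apply: diff_lin => q; exact/differentiable_continuous/differentiable_dot.
Qed.

(** The derivatives of sine, numbered from its primitive [- cos], which must be
    present because differentiating the factor [c.p] of a wave leaves the
    trigonometric factor undifferentiated. *)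
Fixpoint phase (m : nat) (x : R) : R :=
  match m with
  | 0 => - cos x
  | 1 => sin x
  | k.+2 => - phase k x
  end.

Lemma phaseSS m x : phase m.+2 x = - phase m x.
Proof. by []. Qed.

Lemma phase_odd0 m : odd m -> phase m 0 = 0.
Proof.
have [k le_mk] := ubnP m; elim: k m le_mk => // k IH [|[|m]] //=.
  by rewrite sin0.
by rewrite negbK => mk om; rewrite IH ?oppr0 // ltnW.
Qed.

Lemma is_derive_phase m x : is_derive (x : R) (1 : R) (phase m) (phase m.+1 x).
Proof.
suff: is_derive (x : R) (1 : R) (phase m) (phase m.+1 x) /\
    is_derive (x : R) (1 : R) (phase m.+1) (phase m.+2 x) by case.
elim: m => [|m [IH1 IH2]].
  split; first by rewrite -[X in is_derive _ _ _ X]opprK; exact: is_deriveN.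
  by rewrite /= opprK; exact: is_derive_sin.
by split=> //; exact: is_deriveN.
Qed.

Lemma derive_phase_dot m c p v :
  differentiable (phase m \o dot c) p /\
  'D_v (phase m \o dot c) p = dot c v * phase m.+1 (dot c p).
Proof.
have dp : differentiable (phase m) (dot c p).
  by apply/derivable1_diffP; case: (is_derive_phase m (dot c p)).
have dc := differentiable_dot c p.
split; first exact: differentiable_comp.
rewrite deriveE; last exact: differentiable_comp.
rewrite diff_comp //= diff_dot deriv1E ?derive1E; last exact/derivable1_diffP.
by rewrite (@derive_val _ _ _ _ _ _ _ (is_derive_phase m _)).
Qed.

End Phase.
Arguments phase : simpl never.

(** * Plane waves and their jets *)

Section Beams.
Variable R : realType.
Implicit Types (c n p v : 'cV[R]_3) (q : {poly R}).

(** The functions [(c.p) g(n.p)] and [g(n.p)], with [g] running through the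
    derivatives of sine, span a space stable under all derivations.  The
    polynomial [q] stands for its class modulo ['X^2]: its constant coefficient
    goes with [(c.p) g(n.p)] and its linear one with [g(n.p)], where [g] is
    differentiated once less because the factor [c.p] has used up one
    derivation. *)
Definition jet q m c n p : R :=
  q`_0 * (dot c p * phase m.+1 (dot n p)) + q`_1 * phase m (dot n p).

Definition affine (a b : R) : {poly R} := a%:P + b *: 'X.

Lemma coef0_mul_affine q a b : (q * affine a b)`_0 = q`_0 * a.
Proof.
by rewrite /affine mulrDr coefD coefMC -scalerAr coefZ coefMX /= mulr0 addr0.
Qed.

Lemma coef1_mul_affine q a b : (q * affine a b)`_1 = q`_0 * b + q`_1 * a.
Proof.
rewrite /affine mulrDr coefD coefMC -scalerAr coefZ coefMX /=.
by rewrite addrC [b * _]mulrC.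
Qed.

Lemma coef1_affineX a b d : (affine a b ^+ d.+1)`_1 = d.+1%:R * b * a ^+ d.
Proof.
elim: d => [|d IH].
  by rewrite -[affine _ _]mul1r coef1_mul_affine !coef1 /=; ring.
rewrite exprSr coef1_mul_affine IH.
have -> : (affine a b ^+ d.+1)`_0 = a ^+ d.+1.
  elim: d.+1 => [|j IHj]; first by rewrite !expr0 coef1.
  by rewrite exprSr coef0_mul_affine IHj exprSr.
by rewrite -[d.+2%:R]natr1 exprS; ring.
Qed.

(** By the product rule: [n.v] comes from the trigonometric factor and [c.v]
    from the linear one, which takes the coefficient from degree 0 to degree 1.
    This turns iterated derivatives into powers of polynomials. *)
Lemma derive_jet q m c n p v :
  differentiable (jet q m c n) p /\
  'D_v (jet q m c n) p = jet (q * affine (dot n v) (dot c v)) m.+1 c n p.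
Proof.
have [d1 e1] := derive_phase_dot m n p v.
have [d2 e2] := derive_phase_dot m.+1 n p v.
have dc := differentiable_dot c p.
have -> : jet q m c n =
    q`_0 *: (dot c * (phase m.+1 \o dot n)) + q`_1 *: (phase m \o dot n).
  by apply/funext.
have dM : differentiable (dot c * (phase m.+1 \o dot n)) p.
  exact: differentiableM.
split; first by apply: differentiableD; exact: differentiableZ.
rewrite deriveD; [|exact/diff_derivable/differentiableZ..].
rewrite !deriveZ; [|exact/diff_derivable..].
rewrite deriveM; [|exact/diff_derivable..].
rewrite e1 e2 deriveE // diff_dot /jet coef0_mul_affine coef1_mul_affine.
by rewrite /GRing.scale /=; ring.
Qed.

(** Polarisation, amplitude and wave vector. *)
Definition beam : Type := ('cV[R]_3 * 'cV[R]_3 * 'cV[R]_3)%type.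
Definition pol (t : beam) := t.1.1.
Definition amp (t : beam) := t.1.2.
Definition dir (t : beam) := t.2.
Implicit Types (t : beam) (L : seq beam) (Q : beam -> {poly R}).

Definition jets Q m L p : 'cV[R]_3 :=
  \sum_(t <- L) jet (Q t) m (amp t) (dir t) p *: pol t.

(** The trigonometric factor is sine for [k = 0] and cosine for [k = 1]. *)
Definition beams k L p : 'cV[R]_3 :=
  \sum_(t <- L) (dot (amp t) p * phase k.+1 (dot (dir t) p)) *: pol t.

Lemma beams_jets k L : beams k L = jets (fun=> 1) k L.
Proof.
apply/funext => p; apply: eq_bigr => t _.
by rewrite /jet !coef1 mul1r mul0r addr0.
Qed.

Definition slope (i : 'I_3) t : {poly R} := affine (dir t i 0) (amp t i 0).

(** Every derivation is a change of the coefficients, so that derivatives of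
    all orders are obtained without further analysis. *)
Lemma derive_jets Q m L p i :
  differentiable (jets Q m L) p /\
  partial i (jets Q m L) p = jets (fun t => Q t * slope i t) m.+1 L p.
Proof.
rewrite /partial; elim: L => [|t L [IH1 IH2]].
  have -> : jets Q m [::] = cst 0 by apply/funext => r; rewrite /jets big_nil.
  by split; [exact: differentiable_cst | rewrite derive_cst /jets big_nil].
have -> : jets Q m (t :: L) =
    (fun r => jet (Q t) m (amp t) (dir t) r *: pol t) + jets Q m L.
  by apply/funext=> r; rewrite /jets big_cons.
have [d1 e1] := derive_jet (Q t) m (amp t) (dir t) p (delta_mx i 0).
have d2 := differentiableZl (pol t) d1.
split; first exact: differentiableD.
rewrite deriveD; [|exact/diff_derivable..].
rewrite IH2 deriveE // diffZl // -deriveE // e1 !dot_delta.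
by rewrite [in RHS]/jets big_cons.
Qed.

Lemma partial_jets Q m L i :
  partial i (jets Q m L) = jets (fun t => Q t * slope i t) m.+1 L.
Proof. by apply/funext => p; case: (derive_jets Q m L p i). Qed.

Lemma iter_partial_jets Q m L i k :
  iter k (partial i) (jets Q m L) =
  jets (fun t => Q t * slope i t ^+ k) (k + m) L.
Proof.
elim: k => [|k IH]; first by congr jets; apply/funext => t; rewrite mulr1.
rewrite iterS IH partial_jets; congr jets.
by apply/funext => t; rewrite exprSr mulrA.
Qed.

Lemma smooth_beams k L : smooth (beams k L).
Proof.
move=> s p; rewrite beams_jets.
suff [Q [m ->]] : exists Q m,
    foldr (@partial R _) (jets (fun=> 1) k L) s = jets Q m L.
  by case: (derive_jets Q m L p 0).
elim: s => [|i s [Q [m /= ->]]]; first by exists (fun=> 1), k.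
by rewrite partial_jets; eexists; eexists.
Qed.

(** * Taylor series of superpositions of plane waves *)

Lemma jets0 Q m L :
  jets Q m L 0 = phase m 0 *: \sum_(t <- L) (Q t)`_1 *: pol t.
Proof.
rewrite scaler_sumr; apply: eq_bigr => t _.
by rewrite /jet !linear0 mul0r mulr0 add0r scalerA mulrC.
Qed.

Lemma taylor_coef_beams k L (a : 'I_3 -> nat) :
  taylor_coef (beams k L) a =
  (\prod_i (a i)`!%:R)^-1 *: (phase (\sum_i a i + k) 0 *:
    \sum_(t <- L) (\prod_i slope i t ^+ a i)`_1 *: pol t).
Proof.
rewrite beams_jets /taylor_coef !iter_partial_jets jets0.
have -> : (a 0%R + (a 1%R + (a 2%R + k)))%N = (\sum_i a i + k)%N.
  rewrite !big_ord_recl big_ord0 !addnA addn0.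
  by congr (a _ + a _ + a _ + _)%N; apply/val_inj.
congr (_ *: (_ *: _)); apply: eq_bigr => t _; congr ((_ : {poly R})`_ _ *: _).
rewrite !big_ord_recl big_ord0 mulr1 mul1r [LHS]mulrC [X in _ * X]mulrC.
congr (slope _ _ ^+ a _ * (slope _ _ ^+ a _ * slope _ _ ^+ a _));
  exact/val_inj.
Qed.

Lemma taylor_coef_beams_odd k L (a : 'I_3 -> nat) :
  odd (\sum_i a i + k) -> taylor_coef (beams k L) a = 0.
Proof. by move=> ak; rewrite taylor_coef_beams phase_odd0 // scale0r scaler0. Qed.

Lemma taylor_component_beams0 k L : taylor_component (beams k L) 0 = cst 0.
Proof.
apply/funext => p; rewrite /taylor_component big1 // => a _.
rewrite taylor_coef_beams [X in phase _ 0 *: X]big1 ?scaler0 // => t _.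
have -> : \prod_i slope i t ^+ a i = 1; last by rewrite coef1 scale0r.
by rewrite big1 // => i _; case: (a i) => [[|]].
Qed.

(** The factor [c.p] raises the degree, so that [lead d] is of degree
    [d + 1]. *)
Definition lead d L p : 'cV[R]_3 :=
  \sum_(t <- L) (dot (amp t) p * dot (dir t) p ^+ d / d`!%:R) *: pol t.

(** The sum over multi-indices is the multinomial expansion of the power
    [d + 1] of [n.p + (c.p) X], whose coefficient of degree 1 is
    [(d + 1) (c.p) (n.p)^d]. *)
Lemma taylor_component_beamsS k L d :
  taylor_component (beams k L) d.+1 =
  (fun p => phase (d.+1 + k) 0 *: lead d L p).
Proof.
apply/funext => p; transitivity (phase (d.+1 + k) 0 *: \sum_(t <- L)
   (\sum_(a : {ffun 'I_3 -> 'I_d.+2} | (\sum_i a i)%N == d.+1)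
      \prod_i ((a i)`!%:R^-1 *: (p i 0 *: slope i t) ^+ a i))`_1 *: pol t).
  rewrite /taylor_component scaler_sumr.
  under [in RHS]eq_bigr => t _ do rewrite coef_sum scaler_suml scaler_sumr.
  rewrite exchange_big; apply: eq_bigr => a /eqP sa.
  rewrite taylor_coef_beams sa !scaler_sumr; apply: eq_bigr => t _.
  under [in RHS]eq_bigr => i _ do rewrite exprZn scalerA.
  rewrite scaler_prod coefZ !scalerA big_split /= prodfV; congr (_ *: _).
  by ring.
congr (_ *: _); apply: eq_bigr => t _; congr (_ *: _).
rewrite multinomial.
have -> : \sum_i p i 0 *: slope i t = affine (dot (dir t) p) (dot (amp t) p).
  rewrite /slope /affine /dot rmorph_sum scaler_suml -big_split.
  apply: eq_bigr => i _ /=.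
  by rewrite scalerDr scalerA -mul_polyC -polyCM ![p i 0 * _]mulrC.
rewrite coefZ coef1_affineX factS natrM.
have nzS : d.+1%:R != 0 :> R by rewrite pnatr_eq0.
have nzf : d`!%:R != 0 :> R by rewrite pnatr_eq0 -lt0n fact_gt0.
by field; exact/andP.
Qed.

End Beams.

(** * Coordinates in dimension three *)

Section Coordinates.
Variable R : realType.
Implicit Types u v : 'cV[R]_3.

Lemma vec3_eta v : v = vec3 (v 0 0) (v 1 0) (v 2 0).
Proof.
apply/colP => i; rewrite mxE.
by case: i => [[|[|[|//]]] ?]; rewrite /=; congr (v _ _); exact/val_inj.
Qed.

Lemma vec3D x y z x' y' z' :
  vec3 x y z + vec3 x' y' z' = vec3 (x + x') (y + y') (z + z') :> 'cV[R]_3.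
Proof. by apply/colP => i; rewrite !mxE; case: i => [[|[|[|//]]] ?]. Qed.

Lemma vec3N x y z : - vec3 x y z = vec3 (- x) (- y) (- z) :> 'cV[R]_3.
Proof. by apply/colP => i; rewrite !mxE; case: i => [[|[|[|//]]] ?]. Qed.

Lemma vec3Z k x y z : k *: vec3 x y z = vec3 (k * x) (k * y) (k * z) :> 'cV[R]_3.
Proof. by apply/colP => i; rewrite !mxE; case: i => [[|[|[|//]]] ?]. Qed.

Lemma vec3_0 : 0 = vec3 0 0 0 :> 'cV[R]_3.
Proof. by apply/colP => i; rewrite !mxE; case: i => [[|[|[|//]]] ?]. Qed.

Lemma dot_vec3 x y z x' y' z' :
  dot (vec3 x y z) (vec3 x' y' z') = x * x' + y * y' + z * z' :> R.
Proof. by rewrite /dot !big_ord_recl big_ord0 addr0 addrA !mxE. Qed.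

Lemma one_mx3 : 1 = mx3 1 0 0 0 1 0 0 0 1 :> 'M[R]_3.
Proof.
apply/matrixP => i j; rewrite !mxE.
by case: i => [[|[|[|//]]] ?]; case: j => [[|[|[|//]]] ?].
Qed.

Lemma col_mx3 a b c d e f g h k :
  (col 0 (mx3 a b c d e f g h k) = vec3 a d g :> 'cV[R]_3) *
  (col 1 (mx3 a b c d e f g h k) = vec3 b e h :> 'cV[R]_3) *
  (col 2 (mx3 a b c d e f g h k) = vec3 c f k :> 'cV[R]_3).
Proof.
by split; [split|]; apply/colP => i; rewrite !mxE; case: i => [[|[|[|//]]] ?].
Qed.

Lemma mx3M a b c d e f g h k a' b' c' d' e' f' g' h' k' :
  mx3 a b c d e f g h k *m mx3 a' b' c' d' e' f' g' h' k' =
  mx3 (a * a' + b * d' + c * g') (a * b' + b * e' + c * h')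
      (a * c' + b * f' + c * k')
      (d * a' + e * d' + f * g') (d * b' + e * e' + f * h')
      (d * c' + e * f' + f * k')
      (g * a' + h * d' + k * g') (g * b' + h * e' + k * h')
      (g * c' + h * f' + k * k') :> 'M[R]_3.
Proof.
apply/matrixP => i j; rewrite !mxE !big_ord_recl big_ord0 addr0 addrA !mxE.
by case: i => [[|[|[|//]]] ?]; case: j => [[|[|[|//]]] ?].
Qed.

Lemma mx3_vec a b c d e f g h k x y z :
  mx3 a b c d e f g h k *m vec3 x y z =
  vec3 (a * x + b * y + c * z) (d * x + e * y + f * z) (g * x + h * y + k * z)
    :> 'cV[R]_3.
Proof.
apply/colP => i; rewrite !mxE !big_ord_recl big_ord0 addr0 addrA !mxE.
by case: i => [[|[|[|//]]] ?].
Qed.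

Definition cross u v : 'cV[R]_3 :=
  vec3 (u 1 0 * v 2 0 - u 2 0 * v 1 0)
       (u 2 0 * v 0 0 - u 0 0 * v 2 0)
       (u 0 0 * v 1 0 - u 1 0 * v 0 0).

Lemma crossC u v : cross u v = - cross v u.
Proof. by rewrite vec3N; congr vec3; ring. Qed.

Lemma crossvN u v : cross u (- v) = - cross u v.
Proof. by rewrite vec3N /cross !mxE; congr vec3; ring. Qed.

Lemma crossvv u : cross u u = 0.
Proof. by rewrite vec3_0; congr vec3; ring. Qed.

End Coordinates.

(** * The curl of superpositions of plane waves *)

Section Curl.
Variable R : realType.
Implicit Types (p : 'cV[R]_3) (t : beam R) (T L : seq (beam R)).

Lemma partial_coord (F : 'cV[R]_3 -> 'cV[R]_3) i j p :
  differentiable F p -> partial i (fun q => F q j 0) p = partial i F p j 0.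
Proof.
by move=> dF; rewrite /partial derive_mx ?mxE //; exact: diff_derivable.
Qed.

(** The product rule: differentiating the amplitude [c.p] gives [c x u], and
    differentiating the trigonometric factor gives [n x u]. *)
Lemma curl_beams k L p : curl (beams k L) p =
  \sum_(t <- L) (phase k.+1 (dot (dir t) p) *: cross (amp t) (pol t)
    + (dot (amp t) p * phase k.+2 (dot (dir t) p)) *: cross (dir t) (pol t)).
Proof.
have jet_slope i t : jet (1 * slope i t) k.+1 (amp t) (dir t) p =
    dir t i 0 * (dot (amp t) p * phase k.+2 (dot (dir t) p)) +
    amp t i 0 * phase k.+1 (dot (dir t) p).
  rewrite /jet coef0_mul_affine coef1_mul_affine !coef1 /=.
  by rewrite mul0r addr0 !mul1r.
rewrite beams_jets /curl !partial_coord; try exact: (derive_jets _ _ _ _ 0).1.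
rewrite !partial_jets /jets.
apply/colP => i; rewrite summxE mxE !summxE.
case: i => [[|[|[|//]]] ?] /=; rewrite -sumrB; apply: eq_bigr => t _;
  by rewrite !mxE !jet_slope /=; ring.
Qed.

(** From here on a triple of vectors is also read as a triad [(a, b, n)] of
    mutually orthogonal vectors, which gives rise to two beams of wave vector
    [n]. *)
Definition V_beams T : seq (beam R) :=
  flatten [seq [:: (t.1.1, t.1.2, t.2); (t.1.2, t.1.1, t.2)] | t <- T].

Definition W_beams T : seq (beam R) :=
  flatten [seq [:: (- t.1.1, t.1.1, t.2); (t.1.2, t.1.2, t.2)] | t <- T].

Definition right_handed t := cross t.2 t.1.1 = t.1.2 /\ cross t.1.2 t.2 = t.1.1.

Lemma V_beams_cons a b n T p : beams 0 (V_beams ((a, b, n) :: T)) p =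
  sin (dot n p) *: (dot b p *: a + dot a p *: b) + beams 0 (V_beams T) p.
Proof.
rewrite /beams /= !big_cons addrA; congr (_ + _).
by rewrite scalerDr !scalerA mulrC [_ * dot a p]mulrC.
Qed.

Lemma W_beams_cons a b n T p : beams 1 (W_beams ((a, b, n) :: T)) p =
  cos (dot n p) *: (dot b p *: b - dot a p *: a) + beams 1 (W_beams T) p.
Proof.
rewrite /beams /= !big_cons addrA; congr (_ + _).
rewrite scalerDr !scalerN !scalerA addrC /phase opprK.
by rewrite mulrC [_ * dot a p]mulrC.
Qed.

(** The two terms [a x b] and [b x a] cancel, [n x a = b] and
    [n x b = - a]. *)
Lemma curl_V_beams T : {in T, forall t, right_handed t} ->
  curl (beams 0 (V_beams T)) = beams 1 (W_beams T).
Proof.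
move=> rT; apply/funext => p; rewrite curl_beams /beams !big_flatten !big_map.
elim: T rT => [|[[a b] n] T IH] rT; first by rewrite !big_nil.
rewrite !big_cons IH; last by move=> t tT; apply: rT; rewrite inE tT orbT.
congr (_ + _); rewrite !big_nil.
have [/= na bn] := rT _ (mem_head _ _).
rewrite /pol /amp /dir /= !addr0 [cross n b]crossC na bn [cross b a]crossC.
by rewrite addrACA -scalerDr addNr scaler0 add0r addrC.
Qed.

(** Here the terms [a x a] and [b x b] vanish, and the sign of
    [cos' = - sin] cancels those of [n x b = - a] and [n x (- a) = - b]. *)
Lemma curl_W_beams T : {in T, forall t, right_handed t} ->
  curl (beams 1 (W_beams T)) = beams 0 (V_beams T).
Proof.
move=> rT; apply/funext => p; rewrite curl_beams /beams !big_flatten !big_map.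
elim: T rT => [|[[a b] n] T IH] rT; first by rewrite !big_nil.
rewrite !big_cons IH; last by move=> t tT; apply: rT; rewrite inE tT orbT.
congr (_ + _); rewrite !big_nil.
have [/= na bn] := rT _ (mem_head _ _).
rewrite /pol /amp /dir /= !addr0 !crossvN [cross n b]crossC na bn !crossvv.
by rewrite oppr0 !scaler0 !add0r phaseSS !mulrN !scaleNr !scalerN !opprK addrC.
Qed.

Lemma lead_V_cons d a b n T p : lead d (V_beams ((a, b, n) :: T)) p =
  (dot n p ^+ d / d`!%:R) *: (dot b p *: a + dot a p *: b)
  + lead d (V_beams T) p.
Proof.
rewrite /lead /= !big_cons addrA; congr (_ + _).
by rewrite scalerDr !scalerA; congr (_ *: _ + _ *: _); ring.
Qed.

Lemma lead_W_cons d a b n T p : lead d (W_beams ((a, b, n) :: T)) p =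
  (dot n p ^+ d / d`!%:R) *: (dot b p *: b - dot a p *: a)
  + lead d (W_beams T) p.
Proof.
rewrite /lead /= !big_cons addrA; congr (_ + _).
rewrite addrC scalerDr !scalerN !scalerA.
by congr (_ *: _ - _ *: _); ring.
Qed.

(** * Rotations acting on plane waves *)

Definition act (g : 'M[R]_3) t : beam R := (g *m t.1.1, g *m t.1.2, g *m t.2).

Lemma V_beams_act g T :
  V_beams [seq act g t | t <- T] = [seq act g t | t <- V_beams T].
Proof. by rewrite /V_beams map_flatten -!map_comp. Qed.

Lemma W_beams_act g T :
  W_beams [seq act g t | t <- T] = [seq act g t | t <- W_beams T].
Proof.
rewrite /W_beams map_flatten -!map_comp; congr flatten; apply/eq_map => t.
by rewrite /= /act /= mulmxN.
Qed.

Lemma beams_act k g L p : g^T *m g = 1 ->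
  beams k [seq act g t | t <- L] (g *m p) = g *m beams k L p.
Proof.
move=> gg; rewrite /beams big_map mulmx_sumr; apply: eq_bigr => t _.
by rewrite /amp /dir /pol /= !dotM // scalemxAr.
Qed.

Lemma beams_flatten_perm k (h : beam R -> seq (beam R)) T T' :
  perm_eq T T' ->
  beams k (flatten [seq h t | t <- T]) = beams k (flatten [seq h t | t <- T']).
Proof.
move=> TT'; apply/funext => p; rewrite /beams !big_flatten !big_map.
exact: perm_big.
Qed.

End Curl.

(** * The golden ratio and the five frames *)

Section Frames.
Variable R : realType.
Local Notation phi := (phi R).
Local Notation gamma := (ico_gamma R).
Implicit Types (p u v : 'cV[R]_3) (t : beam R).

Lemma sqrt5E : Num.sqrt 5 = 2 * phi - 1 :> R.
Proof. by rewrite /Defs.phi; field. Qed.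

Lemma phi_sqr : phi ^+ 2 = phi + 1.
Proof.
have s5 : Num.sqrt 5 ^+ 2 = 5 :> R by rewrite sqr_sqrtr.
by rewrite /Defs.phi; field: s5.
Qed.

Lemma phiV : phi^-1 = phi - 1.
Proof.
have phi1 : phi * (phi - 1) = 1 by ring: phi_sqr.
have phi0 : phi != 0.
  by apply: contra_eq_neq phi1 => ->; rewrite mul0r eq_sym oner_eq0.
by apply: (mulfI phi0); rewrite divff.
Qed.

Lemma inv2phi : (2 * phi)^-1 = (phi - 1) / 2.
Proof. by rewrite invfM phiV mulrC. Qed.

(** The default value is the next power too, as gamma has order five. *)
Definition gamma_power k : 'M[R]_3 :=
  let h := 2^-1 in let f := phi / 2 in let g := (phi - 1) / 2 in
  nth 1 [:: 1;
    mx3 h (- f) g f g (- h) g h f;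
    mx3 (- g) (- h) f h (- f) (- g) f g h;
    mx3 (- g) h f (- h) (- f) g f (- g) h;
    mx3 h f g (- f) g h g (- h) f] k.

Lemma ico_gammaE : gamma = gamma_power 1.
Proof. by rewrite /ico_gamma /gamma_power /= !mul1r inv2phi. Qed.

Lemma gamma_powerS k : (k < 5)%N -> gamma *m gamma_power k = gamma_power k.+1.
Proof.
rewrite ico_gammaE; case: k => [|[|[|[|[|//]]]]] _; rewrite /gamma_power /=.
  exact: mulmx1.
all: by rewrite ?one_mx3 mx3M; congr mx3; field: phi_sqr.
Qed.

Lemma gamma_orthogonal : gamma^T *m gamma = 1.
Proof.
have -> : gamma^T = gamma_power 4.
  rewrite ico_gammaE; apply/matrixP => i j; rewrite !mxE.
  by case: i => [[|[|[|//]]] ?]; case: j => [[|[|[|//]]] ?].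
rewrite ico_gammaE one_mx3 /gamma_power /= mx3M.
by congr mx3; field: phi_sqr.
Qed.

Definition axes (Q : 'M[R]_3) : seq (beam R) :=
  [:: (col 1 Q, col 2 Q, col 0 Q); (col 2 Q, col 0 Q, col 1 Q);
      (col 0 Q, col 1 Q, col 2 Q)].

Lemma axesM g Q : axes (g *m Q) = [seq act g t | t <- axes Q].
Proof.
have colM j : col j (g *m Q) = g *m col j Q by rewrite !colE mulmxA.
by rewrite /axes /act /= !colM.
Qed.

Definition ico_triads : seq (beam R) :=
  flatten [seq axes (gamma_power k) | k <- iota 0 5].

Lemma gamma_ico_triads :
  perm_eq [seq act gamma t | t <- ico_triads] ico_triads.
Proof.
(* Each frame has three axes, so passing to the next frame is a rotation of the
   list by three places. *)
have -> : [seq act gamma t | t <- ico_triads] = rot 3 ico_triads.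
  rewrite map_flatten -map_comp -[RHS]/(flatten
    [seq axes (gamma_power k.+1) | k <- iota 0 5]).
  congr flatten; apply/eq_in_map => k; rewrite mem_iota add0n => /= k5.
  by rewrite -gamma_powerS // axesM.
by rewrite perm_rot.
Qed.

(** Clear for the coordinate axes, hence for their images under the powers of
    gamma, as gamma preserves the cross product. *)
Lemma right_handed_ico : {in ico_triads, forall t, right_handed t}.
Proof.
have crossM u v : cross (gamma *m u) (gamma *m v) = gamma *m cross u v.
  rewrite (vec3_eta u) (vec3_eta v).
  move: (u 0 0) (u 1 0) (u 2 0) (v 0 0) (v 1 0) (v 2 0) => a b c x y z.
  rewrite ico_gammaE /gamma_power /= !mx3_vec /cross !mxE /=.
  by congr vec3; field: phi_sqr.
have rM t : right_handed t -> right_handed (act gamma t).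
  by case: t => -[a b] n [/= e1 e2]; split; rewrite /= crossM ?e1 ?e2.
have r1 : {in axes 1, forall t, right_handed t}.
  rewrite one_mx3 /axes !col_mx3 => t; rewrite !inE.
  by move=> /or3P[] /eqP ->; split; rewrite /= /cross !mxE /=; congr vec3; ring.
have rk k : (k < 5)%N -> {in axes (gamma_power k), forall t, right_handed t}.
  elim: k => [//|k IH] k5 t; rewrite -gamma_powerS ?(ltnW k5) // axesM.
  by move=> /mapP[s st ->]; apply/rM/IH; rewrite ?(ltnW k5).
by move=> t /flatten_mapP[k]; rewrite mem_iota => k5; exact: rk.
Qed.

(** * The two fields as superpositions of plane waves *)

(** In [V_x] and [W_x] the arguments of the trigonometric functions are
    monomials; writing their coefficients as in [gamma_power] makes the addition
    formulas produce the same atoms on both sides. *)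
Lemma V_field_beams : @V_field R = beams 0 (V_beams ico_triads).
Proof.
apply/funext => p; rewrite (vec3_eta p).
move: (p 0 0) (p 1 0) (p 2 0) => x y z.
rewrite /V_field /cyclic_field !mxE /= /V_x.
have e1 w : phi * w / 2 = phi / 2 * w by rewrite mulrAC.
have e2 w : w / (2 * phi) = (phi - 1) / 2 * w by rewrite inv2phi mulrC.
rewrite ![x / 2]mulrC ![y / 2]mulrC ![z / 2]mulrC !e1 !e2.
rewrite /ico_triads /gamma_power /= one_mx3 !col_mx3.
rewrite !V_beams_cons [beams _ (V_beams [::]) _]big_nil addr0 !dot_vec3.
rewrite !(mul1r, mul0r, add0r, addr0, mulNr).
rewrite ?(sinD, cosD, sinN, cosN).
rewrite !vec3Z !vec3D !vec3Z !vec3D phiV.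
by congr vec3; field: phi_sqr.
Qed.

Lemma W_field_beams : @W_field R = beams 1 (W_beams ico_triads).
Proof.
apply/funext => p; rewrite (vec3_eta p).
move: (p 0 0) (p 1 0) (p 2 0) => x y z.
rewrite /W_field /cyclic_field !mxE /= /W_x.
have e1 w : phi * w / 2 = phi / 2 * w by rewrite mulrAC.
have e2 w : w / (2 * phi) = (phi - 1) / 2 * w by rewrite inv2phi mulrC.
rewrite ![x / 2]mulrC ![y / 2]mulrC ![z / 2]mulrC !e1 !e2.
rewrite /ico_triads /gamma_power /= one_mx3 !col_mx3.
rewrite !W_beams_cons [beams _ (W_beams [::]) _]big_nil addr0 !dot_vec3.
rewrite !(mul1r, mul0r, add0r, addr0, mulNr).
rewrite ?(sinD, cosD, sinN, cosN).
rewrite !vec3Z !vec3N !vec3D !vec3Z !vec3D -exprVn phiV sqrt5E.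
by congr vec3; field: phi_sqr.
Qed.

(** * Leading terms *)

Lemma lead_V5 p : lead 5 (V_beams ico_triads) p = 768^-1 *: M_field p.
Proof.
rewrite (vec3_eta p); move: (p 0 0) (p 1 0) (p 2 0) => x y z.
rewrite /M_field !mxE /=.
rewrite /ico_triads /gamma_power /= one_mx3 !col_mx3.
rewrite !lead_V_cons [lead _ (V_beams [::]) _]big_nil addr0 !dot_vec3.
rewrite !(mul1r, mul0r, add0r, addr0, mulNr).
rewrite !vec3Z !vec3D !vec3Z !vec3D sqrt5E (_ : 5`! = 120)%N //.
by congr vec3; field: phi_sqr.
Qed.

Lemma lead_W4 p : lead 4 (W_beams ico_triads) p = 768^-1 *: N_field p.
Proof.
rewrite (vec3_eta p); move: (p 0 0) (p 1 0) (p 2 0) => x y z.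
rewrite /N_field /cyclic_field !mxE /N_x /=.
rewrite /ico_triads /gamma_power /= one_mx3 !col_mx3.
rewrite !lead_W_cons [lead _ (W_beams [::]) _]big_nil addr0 !dot_vec3.
rewrite !(mul1r, mul0r, add0r, addr0, mulNr).
rewrite !vec3Z !vec3N !vec3D !vec3Z !vec3D sqrt5E (_ : 4`! = 24)%N //.
by congr vec3; field: phi_sqr.
Qed.

(** Only odd [d] are in question, because the value of the [d]-th derivative of
    sine at 0 kills the other components; for W the parities are exchanged. *)
Lemma lead_V_low d p : (d < 5)%N -> odd d -> lead d (V_beams ico_triads) p = 0.
Proof.
move=> d5 od; rewrite (vec3_eta p).
move: (p 0 0) (p 1 0) (p 2 0) => x y z.
rewrite /ico_triads /gamma_power /= one_mx3 !col_mx3.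
rewrite !lead_V_cons [lead _ (V_beams [::]) _]big_nil addr0 !dot_vec3.
rewrite !(mul1r, mul0r, add0r, addr0, mulNr).
rewrite !vec3Z !vec3D !vec3Z !vec3D vec3_0.
case: d od d5 => [|[|[|[|[|//]]]]] // _ _; rewrite !factS fact0 !muln1.
all: by congr vec3; field: phi_sqr.
Qed.

Lemma lead_W_low d p : (d < 4)%N -> ~~ odd d -> lead d (W_beams ico_triads) p = 0.
Proof.
move=> d4 ed; rewrite (vec3_eta p).
move: (p 0 0) (p 1 0) (p 2 0) => x y z.
rewrite /ico_triads /gamma_power /= one_mx3 !col_mx3.
rewrite !lead_W_cons [lead _ (W_beams [::]) _]big_nil addr0 !dot_vec3.
rewrite !(mul1r, mul0r, add0r, addr0, mulNr).
rewrite !vec3Z !vec3N !vec3D !vec3Z !vec3D vec3_0.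
case: d ed d4 => [|[|[|[|//]]]] // _ _; rewrite ?factS fact0 ?muln1.
all: by congr vec3; field: phi_sqr.
Qed.

Lemma M_field_neq0 : (fun p => 768^-1 *: @M_field R p) <> cst 0.
Proof.
move=> /(congr1 (fun F : 'cV[R]_3 -> 'cV[R]_3 => F (vec3 0 1 1) 0 0)) /=.
rewrite /M_field /vec3 !mxE /= => M0.
have : (10 : R) = 0 by rewrite -[RHS](mulr0 (-768)) -M0; field.
by move=> /eqP; rewrite pnatr_eq0.
Qed.

Lemma N_field_neq0 : (fun p => 768^-1 *: @N_field R p) <> cst 0.
Proof.
move=> /(congr1 (fun F : 'cV[R]_3 -> 'cV[R]_3 => F (vec3 1 0 0) 0 0)) /=.
rewrite /N_field /cyclic_field /N_x /vec3 !mxE /= => N0.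
have : Num.sqrt 5 = 0 :> R by rewrite -[RHS](mulr0 384) -N0; field.
by move=> /eqP; rewrite sqrtr_eq0 lern0.
Qed.

(** * Icosahedral symmetry *)

(** A rotation turns each wave into the wave of the rotated triad, and gamma
    permutes the triads. *)
Lemma V_gamma p : V_field (gamma *m p) = gamma *m V_field p.
Proof.
rewrite V_field_beams -(beams_act _ _ _ gamma_orthogonal) -V_beams_act.
by congr (_ _); exact/esym/beams_flatten_perm/gamma_ico_triads.
Qed.

Lemma W_gamma p : W_field (gamma *m p) = gamma *m W_field p.
Proof.
rewrite W_field_beams -(beams_act _ _ _ gamma_orthogonal) -W_beams_act.
by congr (_ _); exact/esym/beams_flatten_perm/gamma_ico_triads.
Qed.

Lemma cyclic_beta (f : R -> R -> R -> R) p :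
  cyclic_field f (ico_beta R *m p) = ico_beta R *m cyclic_field f p.
Proof.
rewrite (vec3_eta p); move: (p 0 0) (p 1 0) (p 2 0) => x y z.
rewrite /ico_beta mx3_vec /cyclic_field !mxE /= mx3_vec.
by rewrite !(mul0r, mul1r, addr0, add0r).
Qed.

Lemma cyclic_alpha (f : R -> R -> R -> R) p :
  (forall x y z, f (- x) (- y) z = - f x y z) ->
  (forall x y z, f (- x) y (- z) = - f x y z) ->
  (forall x y z, f x (- y) (- z) = f x y z) ->
  cyclic_field f (ico_alpha R *m p) = ico_alpha R *m cyclic_field f p.
Proof.
move=> f1 f2 f3.
rewrite (vec3_eta p); move: (p 0 0) (p 1 0) (p 2 0) => x y z.
rewrite /ico_alpha mx3_vec /cyclic_field !mxE /= mx3_vec.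
by rewrite !(mul0r, mul1r, addr0, add0r, mulN1r) f1 f2 f3.
Qed.

Lemma V_alpha p : V_field (ico_alpha R *m p) = ico_alpha R *m V_field p.
Proof.
by apply: cyclic_alpha => x y z; rewrite /V_x !(mulrN, mulNr) !(sinN, cosN); ring.
Qed.

Lemma W_alpha p : W_field (ico_alpha R *m p) = ico_alpha R *m W_field p.
Proof.
by apply: cyclic_alpha => x y z; rewrite /W_x !(mulrN, mulNr) !(sinN, cosN); ring.
Qed.

Lemma W_odd p : W_field (- p) = - W_field p.
Proof.
rewrite /W_field /cyclic_field !mxE vec3N.
by congr vec3; rewrite /W_x !(mulrN, mulNr) !(sinN, cosN); ring.
Qed.

(** Invertibility is carried along since [invmx] fixes singular matrices. *)
Definition equivariant n (F : 'cV[R]_n -> 'cV[R]_n) (A : 'M[R]_n) :=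
  A \in unitmx /\ forall q, F (A *m q) = A *m F q.

Lemma generated_equivariant n (S : set 'M[R]_n) (F : 'cV[R]_n -> 'cV[R]_n) :
  S `<=` equivariant F -> generated_group S `<=` equivariant F.
Proof.
move=> SF A; elim=> {A} [A /SF//||A B _ [uA FA] _ [uB FB]|A _ [uA FA]].
- by split=> [|q]; rewrite ?unitmx1 ?mul1mx.
- by split=> [|q]; rewrite ?unitmx_mul ?uA // -!mulmxA FA FB.
- split=> [|q]; first by rewrite unitmx_inv.
  by rewrite -{2}[q](mulKVmx uA) FA mulKmx.
Qed.

Lemma ico_equivariant (F : 'cV[R]_3 -> 'cV[R]_3) :
  (forall p, F (ico_alpha R *m p) = ico_alpha R *m F p) ->
  (forall p, F (ico_beta R *m p) = ico_beta R *m F p) ->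
  (forall p, F (gamma *m p) = gamma *m F p) ->
  @icosahedral R `<=` equivariant F.
Proof.
move=> Fa Fb Fc; apply: generated_equivariant => A [[->|->]|->]; split=> //.
- apply: (mulmx1_unit (_ : ico_alpha R *m ico_alpha R = 1%:M)).1.
  by rewrite -[1%:M]/1 one_mx3 mx3M; congr mx3; ring.
- apply: (mulmx1_unit (_ : ico_beta R *m (ico_beta R *m ico_beta R) = 1%:M)).1.
  by rewrite -[1%:M]/1 one_mx3 !mx3M; congr mx3; ring.
- exact: (mulmx1_unit gamma_orthogonal).2.
Qed.

Lemma V_equivariant : @icosahedral R `<=` equivariant (@V_field R).
Proof. exact: ico_equivariant V_alpha (cyclic_beta _) V_gamma. Qed.

Lemma W_equivariant : @icosahedral R `<=` equivariant (@W_field R).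
Proof. exact: ico_equivariant W_alpha (cyclic_beta _) W_gamma. Qed.

Lemma equivariant_symmetric A (F : 'cV[R]_3 -> 'cV[R]_3) :
  equivariant F A -> symmetric_under A F.
Proof. by move=> [uA FA]; apply/funext => p /=; rewrite FA mulKmx. Qed.

Lemma curlD (F G : 'cV[R]_3 -> 'cV[R]_3) :
  (forall p, differentiable F p) -> (forall p, differentiable G p) ->
  curl (F \+ G) = curl F \+ curl G.
Proof.
move=> dF dG; apply/funext => p.
have partialD i j : partial i (fun q => (F \+ G) q j 0) p =
    partial i F p j 0 + partial i G p j 0.
  rewrite partial_coord; last exact: differentiableD.
  by rewrite /partial deriveD ?mxE //; exact: diff_derivable.
rewrite /= /curl !partialD !partial_coord // vec3D.
by congr vec3; rewrite opprD addrACA.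
Qed.

End Frames.

Theorem theorem1 (R : realType) :
  let V : 'cV[R]_3 -> 'cV[R]_3 := @V_field R in
  let W : 'cV[R]_3 -> 'cV[R]_3 := @W_field R in
  let I : 'cV[R]_3 -> 'cV[R]_3 := @I_field R in
  (* 1 *)
  ((forall zeta : 'M[R]_3, @icosahedral R zeta -> symmetric_under zeta I) /\
   (forall zeta : 'M[R]_3, @full_icosahedral R zeta -> symmetric_under zeta W)) /\
  (* 2 *)
  [/\ taylor_only_even V, taylor_only_odd W, curl V = W, curl W = V & curl I = I] /\
  (* 3 *)
  (taylor_starts_with V 6 (fun p => 768^-1 *: @M_field R p) /\
   taylor_starts_with W 5 (fun p => 768^-1 *: @N_field R p)).
Proof.
move=> V W I.
have sV : smooth V by rewrite /V V_field_beams; exact: smooth_beams.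
have sW : smooth W by rewrite /W W_field_beams; exact: smooth_beams.
have cV : curl V = W.
  by rewrite /V V_field_beams curl_V_beams -?W_field_beams //; exact: right_handed_ico.
have cW : curl W = V.
  by rewrite /W W_field_beams curl_W_beams -?V_field_beams //; exact: right_handed_ico.
split; [split=> zeta | split; [split=> // | split]].
- move=> Gz; apply: equivariant_symmetric.
  have [uz Vz] := V_equivariant Gz; have [_ Wz] := W_equivariant Gz.
  by split=> // p; rewrite /I /I_field /= Vz Wz mulmxDr.
- move=> [g /W_equivariant [ug Wg] [->|->]]; apply: equivariant_symmetric.
    by [].
  split=> [|p]; last by rewrite !mulNmx /W W_odd Wg.
  by rewrite -scaleN1r unitmxZ // unitrN unitr1.
- split=> // a; apply: contraNN => oa.
  by rewrite /V V_field_beams taylor_coef_beams_odd // addn0.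
- split=> // a; apply: contraTT => ea.
  by rewrite negbK /W W_field_beams taylor_coef_beams_odd // addn1.
- rewrite /I /I_field curlD ?cV ?cW; first by apply/funext => p; rewrite /= addrC.
  + by move=> p; exact: (sV [::]).
  + by move=> p; exact: (sW [::]).
- split=> // [[_|d d6]||]; last exact: M_field_neq0.
  + by rewrite /V V_field_beams taylor_component_beams0.
  + rewrite /V V_field_beams taylor_component_beamsS; apply/funext => p.
    have [od|ed] := boolP (odd d); first by rewrite lead_V_low // scaler0.
    by rewrite phase_odd0 ?scale0r // addn0.
  + rewrite /V V_field_beams taylor_component_beamsS; apply/funext => p.
    by rewrite lead_V5 /phase /= cos0 !opprK scale1r.
- split=> // [[_|d d5]||]; last exact: N_field_neq0.
  + by rewrite /W W_field_beams taylor_component_beams0.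
  + rewrite /W W_field_beams taylor_component_beamsS; apply/funext => p.
    have [od|ed] := boolP (odd d); last by rewrite lead_W_low // scaler0.
    by rewrite phase_odd0 ?scale0r // addn1 /= negbK.
  + rewrite /W W_field_beams taylor_component_beamsS; apply/funext => p.
    by rewrite lead_W4 /phase /= cos0 !opprK scale1r.
Qed.
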